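(* For all $K_1,\dots,K_n\in\mathcal K^n$, $$V(K_1,\dots,K_n)=\int_{\operatorname{int}(B^n)\setminus\{o\}}h_{K_n}\Big(\frac{x}{|x|}\Big)\,d\mathrm{MA}(h_{K_1},\dots,h_{K_{n-1}},q;x),$$ where $q(x)=|x|^2/2$ (the measure gives zero mass to $\{o\}$).
   Context: $\mathcal K^n$ is the set of convex bodies in $\mathbb R^n$; $h_K(x)=\max_{y\in K}\langle x,y\rangle$; $\operatorname{int}(B^n)$ is the open unit ball. The mixed volume $V$ is the unique symmetric map $(\mathcal K^n)^n\to\mathbb R$ with $V_n(\sum_i\lambda_iK_i)=\sum\lambda_{i_1}\cdots\lambda_{i_n}V(K_{i_1},\dots,K_{i_n})$ for $\lambda_i\ge0$ ($V_n$ = volume). For convex $v:\mathbb R^n\to\mathbb R$, $\mathrm{MA}(v;B)=V_n(\bigcup_{b\in B}\partial v(b))$, and the mixed Monge–Ampère measure is the unique family $\mathrm{MA}(w_1,\dots,w_n;\cdot)$, symmetric in its entries, with $\mathrm{MA}(\sum_i\lambda_iv_i;\cdot)=\sum\lambda_{i_1}\cdots\lambda_{i_n}\mathrm{MA}(v_{i_1},\dots,v_{i_n};\cdot)$ for $\lambda_i\ge0$. *)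

(* Defs.v *)
(* R^n is modelled as row vectors 'rV[R]_n over an
   arbitrary R : realType, with the (product = Euclidean) topology of
   matrix_topology. *)
From HB Require Import structures.
From mathcomp Require Import all_boot all_order all_algebra all_fingroup.
From mathcomp Require Import all_classical all_reals all_analysis.

Set Implicit Arguments.
Unset Strict Implicit.
Unset Printing Implicit Defensive.

Import Order.TTheory GRing.Theory Num.Theory numFieldNormedType.Exports.
Local Open Scope classical_set_scope.
Local Open Scope ring_scope.

Section Defs.
Variables (R : realType) (n : nat).
Local Notation vec := 'rV[R]_n.

Definition dotv (x y : vec) : R := \sum_(i < n) x ord0 i * y ord0 i.
Definition enorm (x : vec) : R := Num.sqrt (dotv x x).

Definition borelRn := g_sigma_algebraType (@open (vec : topologicalType)).

Definition box (a b : vec) : set vec :=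
  [set x | forall i : 'I_n, a ord0 i <= x ord0 i <= b ord0 i].
Definition boxvol (a b : vec) : R :=
  \prod_(i < n) Num.max 0 (b ord0 i - a ord0 i).
Definition lebesgue_vol (A : set vec) : \bar R :=
  ereal_inf [set s | exists a b : nat -> vec,
     A `<=` \bigcup_k box (a k) (b k) /\
     s = (\sum_(0 <= k <oo) (boxvol (a k) (b k))%:E)%E].

Definition convex_set (K : set vec) : Prop :=
  forall x y (t : R), K x -> K y -> 0 <= t <= 1 -> K ((1 - t) *: x + t *: y).
Definition convex_body (K : set vec) : Prop :=
  K !=set0 /\ compact K /\ convex_set K.
Definition supp_fun (K : set vec) (x : vec) : R := sup [set dotv x y | y in K].

Definition convex_fun (v : vec -> R) : Prop :=
  forall x y (t : R), 0 <= t <= 1 ->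
    v ((1 - t) *: x + t *: y) <= (1 - t) * v x + t * v y.

Definition mink_comb (m : nat) (lam : 'I_m -> R) (K : 'I_m -> set vec) : set vec :=
  [set x | exists y : 'I_m -> vec, (forall i, K i (y i)) /\
                                   x = \sum_(i < m) lam i *: y i].

Definition subdiff (v : vec -> R) (b : vec) : set vec :=
  [set y | forall z, v b + dotv y (z - b) <= v z].
Definition MA (v : vec -> R) (B : set vec) : \bar R :=
  lebesgue_vol (\bigcup_(b in B) subdiff v b).

Definition is_mixed_volume (V : ('I_n -> set vec) -> R) : Prop :=
  (forall (K : 'I_n -> set vec) (s : {perm 'I_n}),
      (forall i, convex_body (K i)) -> V (fun i => K (s i)) = V K) /\
  (forall (m : nat) (lam : 'I_m -> R) (K : 'I_m -> set vec),
      (forall i, 0 <= lam i) -> (forall i, convex_body (K i)) ->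
      lebesgue_vol (mink_comb lam K) =
      (\sum_(f : {ffun 'I_n -> 'I_m}) (\prod_(j < n) lam (f j)) *
                                       V (fun j => K (f j)))%:E).

Definition is_mixed_MA
    (MAm : ('I_n -> (vec -> R)) -> {measure set borelRn -> \bar R}) : Prop :=
  (forall (w : 'I_n -> (vec -> R)) (s : {perm 'I_n}) (B : set borelRn),
      (forall i, convex_fun (w i)) -> measurable B ->
      MAm (fun i => w (s i)) B = MAm w B) /\
  (forall (m : nat) (lam : 'I_m -> R) (v : 'I_m -> (vec -> R)) (B : set borelRn),
      (forall i, 0 <= lam i) -> (forall i, convex_fun (v i)) -> measurable B ->
      MA (fun x => \sum_(i < m) lam i * v i x) B =
      (\sum_(f : {ffun 'I_n -> 'I_m})
          (\prod_(j < n) lam (f j))%:E * MAm (fun j => v (f j)) B)%E).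

Definition qfun (x : vec) : R := enorm x ^+ 2 / 2.
Definition punctured_ball : set borelRn := [set x : vec | enorm x < 1 /\ x != 0].

End Defs.

(* Main.v *)
(** Write L = K_n and let S range over the subsets of the index set. Polarizing
the two defining polynomial identities expresses n! V(K_1,..,K_{n-1},L) and
n! mu as signed sums over S. For S containing the last index, with
P_S = sum_{i in S, i < n} K_i, the summands are the volume of P_S + B + eL and
MA(h_{P_S} + r q; .), where B is the unit ball; the other summands do not
depend on e or r.

For a convex body P, subdiff (h_P + r q)(x) is the set of y such that
p = y - r x lies in P and h_P(x) = <p, x>, i.e. p is the point of P nearest to
y and y - p = r x. Hence MA(h_P + r q; .) of a cone cut by the unit ball is the
volume of the part of the r-parallel body of P lying over these normals, and
P + B + eL is, up to O(e^2), the parallel body of P with the direction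
dependent radius 1 + e h_L(u). Partitioning the directions into cells on which
h_L varies by at most e turns this into an O(e^2) comparison between vol(P_S +
B + eL) and a Riemann sum of MA terms. The alternating sum over S is then an
identity between functions affine in e up to O(e^2), whose linear coefficients
are n! V(K) and n! times a Riemann sum of the integral.

All volumes are compared through inclusions, and additivity is taken from the
measures MAm, so no property of the Lebesgue measure beyond monotonicity is
needed. *)
Require Import Defs.
From HB Require Import structures.
From mathcomp Require Import all_boot all_order all_algebra all_fingroup.
From mathcomp Require Import all_classical all_reals all_analysis.
From mathcomp Require Import ring lra.
Import Order.TTheory GRing.Theory Num.Theory numFieldNormedType.Exports.
Local Open Scope classical_set_scope.
Local Open Scope ring_scope.

(** * Euclidean geometry *)

Lemma continuous_sumr {K : numFieldType} {V : normedModType K}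
    {T : topologicalType} {I : finType} (F : I -> T -> V) :
  (forall i, continuous (F i)) -> continuous (fun x => \sum_i F i x).
Proof.
by move=> Fc; apply: continuous_big => // -[x y]; exact: add_continuous.
Qed.

Section Euclidean.
Context {R : realType} {n : nat}.
Implicit Types x y z : 'rV[R]_n.

Lemma dotvC x y : dotv x y = dotv y x.
Proof. by apply: eq_bigr => i _; rewrite mulrC. Qed.

Lemma dotvDr x y z : dotv x (y + z) = dotv x y + dotv x z.
Proof. by rewrite /dotv -big_split/=; apply: eq_bigr => i _; rewrite mxE mulrDr. Qed.

Lemma dotvZr a x y : dotv x (a *: y) = a * dotv x y.
Proof. by rewrite /dotv big_distrr/=; apply: eq_bigr => i _; rewrite mxE mulrCA. Qed.

Lemma dotvDl x y z : dotv (x + y) z = dotv x z + dotv y z.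
Proof. by rewrite dotvC dotvDr !(dotvC z). Qed.

Lemma dotvZl a x y : dotv (a *: x) y = a * dotv x y.
Proof. by rewrite dotvC dotvZr dotvC. Qed.

Lemma dotvNr x y : dotv x (- y) = - dotv x y.
Proof. by rewrite -scaleN1r dotvZr mulN1r. Qed.

Lemma dotvNl x y : dotv (- x) y = - dotv x y.
Proof. by rewrite dotvC dotvNr dotvC. Qed.

Definition dotvE := (dotvDr, dotvDl, dotvZr, dotvZl, dotvNr, dotvNl).

Lemma dotv0r x : dotv x 0 = 0.
Proof. by rewrite -(scale0r (0 : 'rV[R]_n)) dotvZr mul0r. Qed.

Lemma dotv0l x : dotv 0 x = 0.
Proof. by rewrite dotvC dotv0r. Qed.

Lemma dotv_sumr (I : finType) x (F : I -> 'rV[R]_n) :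
  dotv x (\sum_i F i) = \sum_i dotv x (F i).
Proof. by apply: (big_morph (dotv x)) => [y z|]; rewrite ?dotv0r ?dotvDr. Qed.

Lemma dotvv_ge0 x : 0 <= dotv x x.
Proof. by apply: sumr_ge0 => i _; rewrite -expr2 sqr_ge0. Qed.

Lemma dotvv_eq0 x : dotv x x = 0 -> x = 0.
Proof.
move=> /eqP; rewrite psumr_eq0 => [/allP x0|i _]; last by rewrite -expr2 sqr_ge0.
apply/rowP => i; rewrite mxE; apply/eqP.
by have := x0 i (mem_index_enum i); rewrite mulf_eq0 orbb.
Qed.

Lemma enorm_ge0 x : 0 <= enorm x.
Proof. exact: sqrtr_ge0. Qed.

Lemma enorm_sqr x : enorm x ^+ 2 = dotv x x.
Proof. by rewrite sqr_sqrtr ?dotvv_ge0. Qed.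

Lemma enorm0 : enorm (0 : 'rV[R]_n) = 0.
Proof. by rewrite /enorm dotv0r sqrtr0. Qed.

Lemma enorm_gt0 x : (0 < enorm x) = (x != 0).
Proof.
rewrite lt_neqAle enorm_ge0 andbT eq_sym; congr (~~ _).
apply/eqP/eqP => [x0|->]; last exact: enorm0.
by apply: dotvv_eq0; rewrite -enorm_sqr x0 expr0n.
Qed.

Lemma enormZ a x : 0 <= a -> enorm (a *: x) = a * enorm x.
Proof.
move=> a0; rewrite /enorm !dotvE mulrA -expr2 sqrtrM ?sqr_ge0//.
by rewrite sqrtr_sqr ger0_norm.
Qed.

Lemma enorm_le x (c : R) : 0 <= c -> (enorm x <= c) = (dotv x x <= c ^+ 2).
Proof. by move=> c0; rewrite -enorm_sqr ler_sqr// nnegrE ?enorm_ge0. Qed.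

(** The squared norm of |y| x - |x| y equals 2|x||y| (|x||y| - <x,y>), so its sign gives the
    bound. *)
Lemma cauchy_schwarz x y : dotv x y <= enorm x * enorm y.
Proof.
have [->|x0] := eqVneq x 0; first by rewrite dotv0l enorm0 mul0r.
have [->|y0] := eqVneq y 0; first by rewrite dotv0r enorm0 mulr0.
have := dotvv_ge0 (enorm y *: x - enorm x *: y).
rewrite !dotvE (dotvC y x) -!enorm_sqr.
have : 0 < enorm x * enorm y by rewrite mulr_gt0 ?enorm_gt0.
move: (enorm x) (enorm y) (dotv x y) => a b c ab0 h.
rewrite -(ler_pM2l ab0); nra.
Qed.

Lemma continuous_enorm_sub y : continuous (fun x : 'rV[R]_n => enorm (y - x)).
Proof.
move=> x; apply: (@continuous_comp _ _ _ (fun x => dotv (y - x) (y - x)) Num.sqrt).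
  2: exact: sqrt_continuous.
apply: continuous_sumr => {}i {}x.
have h : (y - z) ord0 i @[z --> x] --> (y - x) ord0 i.
  rewrite (_ : (fun z => _) = (fun z => y ord0 i - z ord0 i)).
    by rewrite !mxE; apply: (cvgB (cvg_cst _) (@coord_continuous _ _ _ ord0 i _)).
  by apply/funext => z; rewrite !mxE.
exact: (cvgM h h).
Qed.

Lemma continuous_dotv y : continuous (fun x : 'rV[R]_n => dotv x y).
Proof.
apply: continuous_sumr => i x.
exact: (cvgM (@coord_continuous _ _ _ ord0 i x) (cvg_cst _)).
Qed.

Lemma continuous_enorm : continuous (@enorm R n).
Proof.
have h : (@enorm R n) = (fun x => enorm (0 - x)).
  by apply/funext => x; rewrite sub0r /enorm !dotvE opprK.
by rewrite h; exact: continuous_enorm_sub.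
Qed.

End Euclidean.

(** * Support functions and nearest points *)

Section ConvexBodies.
Context {R : realType} {n : nat}.
Implicit Types (x y z : 'rV[R]_n) (K P : set 'rV[R]_n).

Lemma supp_max K x : convex_body K ->
  exists2 y, K y & forall z, K z -> dotv x z <= dotv x y.
Proof.
case=> K0 [Kc _].
have [|y Ky ymax] := @compact_EVT_max _ R (dotv x) K K0 Kc.
  apply: continuous_subspaceT => y.
  rewrite (_ : dotv x = fun z => dotv z x); last by apply/funext => z; exact: dotvC.
  exact: continuous_dotv.
exists y; first by rewrite inE in Ky.
by move=> z Kz; apply: ymax; rewrite inE.
Qed.

Lemma supp_ge K x y : convex_body K -> K y -> dotv x y <= supp_fun K x.
Proof.
move=> cK Ky; have [z Kz zmax] := supp_max K x cK.
apply: ub_le_sup; last by exists y.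
by exists (dotv x z) => _ [t Kt <-]; exact: zmax.
Qed.

Lemma supp_attained K x : convex_body K ->
  exists2 y, K y & supp_fun K x = dotv x y.
Proof.
move=> cK; have [y Ky ymax] := supp_max K x cK; exists y => //.
apply/eqP; rewrite eq_le supp_ge// andbT.
apply: ge_sup; first by exists (dotv x y), y.
by move=> _ [z Kz <-]; exact: ymax.
Qed.

Lemma supp_funD K x y : convex_body K ->
  supp_fun K (x + y) <= supp_fun K x + supp_fun K y.
Proof.
move=> cK; have [z Kz ->] := supp_attained K (x + y) cK.
by rewrite dotvDl lerD ?supp_ge.
Qed.

Lemma supp_fun0 K : convex_body K -> supp_fun K 0 = 0.
Proof. by move=> cK; have [z Kz ->] := supp_attained K 0 cK; rewrite dotv0l. Qed.

Lemma supp_funZ K a x : convex_body K -> 0 <= a ->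
  supp_fun K (a *: x) = a * supp_fun K x.
Proof.
move=> cK a0; apply/eqP; rewrite eq_le; apply/andP; split.
  have [z Kz ->] := supp_attained K (a *: x) cK.
  by rewrite dotvZl ler_wpM2l ?supp_ge.
have [z Kz ->] := supp_attained K x cK.
by rewrite -dotvZl supp_ge.
Qed.

Lemma convex_supp_fun K : convex_body K -> convex_fun (supp_fun K).
Proof.
move=> cK x y t /andP[t0 t1]; apply: le_trans (supp_funD _ _ _ cK) _.
by rewrite !supp_funZ ?subr_ge0.
Qed.

Lemma convex_qfun : convex_fun (@qfun R n).
Proof.
move=> x y t /andP[t0 t1]; rewrite /qfun !enorm_sqr.
have := mulr_ge0 (mulr_ge0 t0 (_ : 0 <= 1 - t)) (dotvv_ge0 (x - y)).
rewrite subr_ge0 => /(_ t1); rewrite !dotvE (dotvC y x).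
by move: (dotv x x) (dotv y y) (dotv x y) => a b c; nra.
Qed.

(** A minimizer p of the distance to y: moving from p towards z by t cannot decrease the distance,
    and the first-order term in t is the inner product in question. *)
Lemma nearest_point P y : convex_body P ->
  exists2 p, P p & forall z, P z -> dotv (z - p) (y - p) <= 0.
Proof.
case=> P0 [Pc Pconv].
have [|p] := @compact_EVT_min _ R (fun z => enorm (y - z)) P P0 Pc.
  by apply: continuous_subspaceT => z; exact: continuous_enorm_sub.
rewrite inE => Pp pmin; exists p => // z Pz.
rewrite leNgt; apply/negP => h.
have key t : 0 <= t <= 1 -> 2 * t * dotv (z - p) (y - p) <= t ^+ 2 * dotv (z - p) (z - p).
  move=> t01; have := pmin _ (mem_set (Pconv _ _ _ Pp Pz t01)).
  rewrite enorm_le ?enorm_ge0// enorm_sqr.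
  have -> : y - ((1 - t) *: p + t *: z) = (y - p) - t *: (z - p).
    by apply/rowP => i; rewrite !mxE; ring.
  rewrite ![dotv (y - p - _) _]dotvDl ![dotv _ (y - p - _)]dotvDr.
  by rewrite !(dotvNr, dotvNl, dotvZr, dotvZl) (dotvC (y - p)); lra.
move: (dotv (z - p) (y - p)) (dotv (z - p) (z - p)) h (dotvv_ge0 (z - p)) key => a b a0 b0 key.
(* For t = a/(a+b) one has tb = a - ta < a, against 2a <= tb. *)
have ab : 0 < a + b by lra.
have := key (a / (a + b)).
have -> : 0 <= a / (a + b) <= 1.
  by apply/andP; split; [apply: divr_ge0; lra|rewrite ler_pdivrMr// mul1r; lra].
set t := a / (a + b); move=> /(_ isT) h.
have tE : t * (a + b) = a by rewrite /t divfK ?gt_eqF.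
have t0 : 0 < t by rewrite divr_gt0.
have : 2 * a <= t * b by rewrite -(ler_pM2l t0); nra.
nra.
Qed.

(** If p is the point of P nearest to y, then P attains its support in direction y - p at p, so the
    hypothesis in that direction forces |y - p|^2 <= 0. *)
Lemma mem_supp P y : convex_body P ->
  (forall z, dotv z y <= supp_fun P z) -> P y.
Proof.
move=> cP yP; have [p Pp pmin] := nearest_point P y cP.
have [z Pz zE] := supp_attained P (y - p) cP.
have := yP (y - p); rewrite zE => h1; have := pmin _ Pz => h2.
suff -> : y = p by [].
apply/subr0_eq/dotvv_eq0/eqP; rewrite eq_le dotvv_ge0 andbT.
have uE w : dotv (y - p) (w - p) = dotv (y - p) w - dotv (y - p) p.
  by rewrite dotvDr dotvNr.
by move: h1 h2; rewrite (dotvC (z - p)) !uE; lra.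
Qed.

Lemma convex_body_bounded K : convex_body K ->
  exists2 M : R, 0 < M & forall l, K l -> enorm l <= M.
Proof.
case=> K0 [Kc _].
have [|p] := @compact_EVT_max _ R (fun z => enorm z) K K0 Kc.
  by apply: continuous_subspaceT => z; exact: continuous_enorm.
rewrite inE => Kp pmax; exists (enorm p + 1) => [|l Kl].
  by rewrite ltr_wpDl ?enorm_ge0.
by rewrite (le_trans (pmax _ (mem_set Kl)))// lerDl.
Qed.

(** Compactness comes from Tychonoff: the set is a continuous image of the product of the [K i]. *)
Lemma convex_body_mink (m : nat) (lam : 'I_m -> R) (K : 'I_m -> set 'rV[R]_n) :
  (forall i, convex_body (K i)) -> convex_body (mink_comb lam K).
Proof.
move=> cK; split; [|split].
- have [y yK] := choice (fun i => (cK i).1).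
  by exists (\sum_i lam i *: y i), y.
- rewrite (_ : mink_comb lam K =
    (fun y : prod_topology (fun _ : 'I_m => 'rV[R]_n) => \sum_i lam i *: y i) @`
      [set y | forall i, K i (y i)]).
    apply: (@continuous_compact (prod_topology (fun _ : 'I_m => 'rV[R]_n)) 'rV[R]_n);
      last by apply: tychonoff => i; case: (cK i) => _ [].
    apply: continuous_subspaceT; apply: continuous_sumr => i y.
    have pc : continuous (fun y : prod_topology (fun _ : 'I_m => 'rV[R]_n) => y i).
      exact: proj_continuous.
    exact: (continuous_comp (pc y) (@scaler_continuous _ _ (lam i) _)).
  by apply/seteqP; split=> [x [y [yK ->]]|x [y yK <-]]; exists y.
- move=> _ _ t [x [xK ->]] [y [yK ->]] t01.
  exists (fun i => (1 - t) *: x i + t *: y i); split=> [i|].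
    by case: (cK i) => _ [_]; apply.
  rewrite !scaler_sumr -big_split/=; apply: eq_bigr => i _.
  by rewrite scalerDr !scalerA ![lam i * _]mulrC.
Qed.

Lemma supp_fun_mink (m : nat) (lam : 'I_m -> R) (K : 'I_m -> set 'rV[R]_n) x :
  (forall i, 0 <= lam i) -> (forall i, convex_body (K i)) ->
  supp_fun (mink_comb lam K) x = \sum_i lam i * supp_fun (K i) x.
Proof.
move=> lam0 cK; have cM := convex_body_mink _ lam _ cK.
apply/eqP; rewrite eq_le; apply/andP; split.
  have [_ [y [yK ->]] ->] := supp_attained _ x cM.
  rewrite dotv_sumr; apply: ler_sum => i _.
  by rewrite dotvZr ler_wpM2l ?supp_ge.
have yP i : exists y, K i y /\ supp_fun (K i) x = dotv x y.
  by have [y] := supp_attained _ x (cK i); exists y.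
have [y yK] := choice yP.
under eq_bigr => i _ do rewrite (yK i).2 -dotvZr.
rewrite -dotv_sumr; apply: supp_ge => //.
by exists y; split => // i; case: (yK i).
Qed.

Definition unit_ball : set 'rV[R]_n := [set x | enorm x <= 1].

Lemma convex_body_unit_ball : convex_body unit_ball.
Proof.
split; [|split].
- by exists 0; rewrite /unit_ball /= enorm0.
- apply: bounded_closed_compact.
    exists 1; split; first exact: num_real.
    (* The norm behind the topology is the maximum of the coordinates, which is at most [enorm]. *)
    move=> M M1 x /= x1; rewrite [leLHS]mx_normrE; apply/bigmax_leP; split => /=.
      by rewrite (le_trans _ (ltW M1)).
    move=> [i j] _ /=; rewrite (ord1 i) (le_trans _ (ltW M1))//.
    rewrite (le_trans _ x1)// -sqrtr_sqr ler_sqrt ?dotvv_ge0// /dotv (bigD1 j)//=.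
    by rewrite expr2 lerDl; apply: sumr_ge0 => k _; rewrite -expr2 sqr_ge0.
  rewrite (_ : unit_ball = (@enorm R n) @^-1` [set y | y <= 1]) //.
  by apply: closed_comp; [move=> x _; exact: continuous_enorm|exact: closed_le].
- move=> x y t /=; rewrite /unit_ball/= !enorm_le// expr1n => x1 y1 /andP[t0 t1].
  have := mulr_ge0 (mulr_ge0 t0 (_ : 0 <= 1 - t)) (dotvv_ge0 (x - y)).
  rewrite subr_ge0 => /(_ t1); rewrite !dotvE (dotvC y x).
  by move: x1 y1; move: (dotv x x) (dotv y y) (dotv x y) => a b c; nra.
Qed.

End ConvexBodies.

(** * Subdifferentials and parallel bodies *)

Section ParallelSets.
Context {R : realType} {n : nat}.
Implicit Types (x y z : 'rV[R]_n) (K P L A : set 'rV[R]_n).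

(** Write p = y - rho x. Testing the subgradient inequality at x + t w and letting t tend to 0
    removes the quadratic term: subadditivity of h_P gives <p,w> <= h_P(w), hence p in P, and w = -x
    gives <p,x> >= h_P(x). Conversely the defect at z is h_P(z) - <p,z> + rho |z - x|^2 / 2. *)
Lemma subdiff_supp_qfun P (rho : R) x y : convex_body P -> 0 <= rho ->
  subdiff (fun z => supp_fun P z + rho * qfun z) x y <->
  P (y - rho *: x) /\ dotv x (y - rho *: x) = supp_fun P x.
Proof.
move=> cP rho0; split=> [sub|[Pp xp] z].
- have bnd t w : 0 <= t -> t * dotv (y - rho *: x) w <=
      supp_fun P (x + t *: w) - supp_fun P x + rho * t ^+ 2 * dotv w w / 2.
    move=> t0; have := sub (x + t *: w); rewrite (addrC x) addrK /qfun !enorm_sqr.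
    rewrite !dotvE (dotvC w x); move: (supp_fun _ _) (supp_fun _ _) => a b; lra.
  have lim (a b c : R) : (forall t : R, 0 < t <= 1 -> a <= b + t * c) -> a <= b.
    move=> h; apply/ler_addgt0Pr => e e0.
    (* This t lies in (0,1] and makes t|c| at most e. *)
    pose t := e / (`|c| + e); have c0 := normr_ge0 c.
    have ce0 : 0 < `|c| + e by lra.
    have t01 : 0 < t <= 1.
      by rewrite divr_gt0//= ler_pdivrMr// mul1r lerDr.
    apply: (le_trans (h _ t01)); rewrite lerD2l.
    have tE : t * (`|c| + e) = e by rewrite divfK ?gt_eqF.
    have /andP[t0 _] := t01.
    have := ler_wpM2l (ltW t0) (ler_norm c); nra.
  have Pp : P (y - rho *: x).
    apply: mem_supp => // w; apply: (@lim _ _ (rho * dotv w w / 2)) => t /andP[t0 _].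
    rewrite -(ler_pM2l t0) dotvC (le_trans (bnd _ _ (ltW t0)))//.
    have := supp_funD P x (t *: w) cP; rewrite (supp_funZ _ _ w cP (ltW t0)).
    by move: (supp_fun _ _) (supp_fun _ _) (supp_fun _ _) => a b c; lra.
  split=> //; apply/eqP; rewrite eq_le supp_ge//=.
  apply: (@lim _ _ (rho * dotv x x / 2)) => t /andP[t0 t1].
  rewrite -(ler_pM2l t0) dotvC.
  have := bnd t (- x) (ltW t0).
  have -> : x + t *: - x = (1 - t) *: x by rewrite scalerN scalerBl scale1r.
  rewrite supp_funZ ?subr_ge0// dotvNl !dotvNr.
  by move: (supp_fun _ _) (dotv (y - _) _) (dotv x x) => a b c; lra.
- have := supp_ge P z _ cP Pp; rewrite -xp /qfun !enorm_sqr.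
  have := mulr_ge0 rho0 (dotvv_ge0 (z - x)).
  rewrite !dotvE (dotvC x y) (dotvC x z) (dotvC y z).
  lra.
Qed.

(** The subdifferential at x depends only on rho x and, by homogeneity of h_P, on the ray of x. A
    change of weight is thus a rescaling of x. *)
Lemma bigcup_subdiff_scale P (rho sigma : R) A : convex_body P ->
  0 < rho -> 0 < sigma ->
  \bigcup_(b in A) subdiff (fun z => supp_fun P z + rho * qfun z) b =
  \bigcup_(b in [set x | A ((sigma / rho) *: x)])
     subdiff (fun z => supp_fun P z + sigma * qfun z) b.
Proof.
move=> cP rho0 sigma0; apply/seteqP; split=> y [b Ab].
- move/subdiff_supp_qfun => /(_ cP (ltW rho0)) [Pp bp].
  exists ((rho / sigma) *: b).
    rewrite /= scalerA; suff -> : sigma / rho * (rho / sigma) = 1 by rewrite scale1r.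
    by field; rewrite !gt_eqF.
  apply/subdiff_supp_qfun => //; first exact: ltW.
  rewrite scalerA (_ : sigma * _ = rho); last by field; rewrite gt_eqF.
  by rewrite dotvZl supp_funZ ?divr_ge0 ?ltW// bp.
- move/subdiff_supp_qfun => /(_ cP (ltW sigma0)) [Pp bp].
  exists ((sigma / rho) *: b); first exact: Ab.
  apply/subdiff_supp_qfun => //; first exact: ltW.
  rewrite scalerA (_ : rho * _ = sigma); last by field; rewrite gt_eqF.
  by rewrite dotvZl supp_funZ ?divr_ge0 ?ltW// bp.
Qed.

Lemma supp_fun_bound L (M : R) x : convex_body L -> (forall l, L l -> enorm l <= M) ->
  `|supp_fun L x| <= M * enorm x.
Proof.
move=> cL LM; have [l Ll ->] := supp_attained L x cL.
have h (z : 'rV[R]_n) : dotv z l <= M * enorm z.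
  rewrite (le_trans (cauchy_schwarz _ _))// mulrC.
  by rewrite ler_wpM2r ?enorm_ge0 ?LM.
rewrite ler_norml h andbT lerNl -dotvNl.
suff -> : enorm x = enorm (- x) by [].
by rewrite /enorm !dotvE opprK.
Qed.

(** For u = x/|x| and c = eM the main hypothesis reads 2|x| <= 1 + e h_L(u) - c^2. With l attaining
    h_L(x), the remainder b = 2x - e l satisfies |b|^2 = (2|x| - e h_L(u))^2 + e^2 (|l|^2 -
    h_L(u)^2) <= (1 - c^2)^2 + c^2 <= 1. *)
Lemma subdiff_sub_parallel P L (M e : R) x y :
  convex_body P -> convex_body L -> (forall l, L l -> enorm l <= M) ->
  0 <= e -> 0 <= M -> e * M <= 1 / 2 ->
  2 * enorm x ^+ 2 <= (1 - e ^+ 2 * M ^+ 2) * enorm x + e * supp_fun L x ->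
  subdiff (fun z => supp_fun P z + 2 * qfun z) x y ->
  exists p l b, [/\ P p, L l, enorm b <= 1 & y = p + e *: l + b].
Proof.
move=> cP cL LM e0 M0 eM xA /subdiff_supp_qfun => /(_ cP (ler0n _ _)) [Pp _].
have [l Ll hl] := supp_attained L x cL.
exists (y - 2 *: x), l, (2 *: x - e *: l); split => //; last first.
  by apply/rowP => i; rewrite !mxE; ring.
rewrite enorm_le// !dotvE (dotvC l x) -!enorm_sqr -hl.
have := supp_fun_bound _ _ x cL LM; rewrite ler_norml.
have := LM l Ll; have := enorm_ge0 l; have := enorm_ge0 x.
move: xA; move: (enorm x) (supp_fun L x) (enorm l) => u H v xA u0 v0 vM /andP[H1 H2].
have ev : e ^+ 2 * v ^+ 2 <= (e * M) ^+ 2.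
  by rewrite -exprMn ler_sqr ?nnegrE ?mulr_ge0// ler_wpM2l.
have eM0 : 0 <= e * M by rewrite mulr_ge0.
rewrite expr1n; move: u0; rewrite le_eqVlt => /orP[/eqP u0|u0].
  have H0 : H = 0 by move: H1 H2; rewrite -u0 mulr0; lra.
  by rewrite H0 -u0; nra.
have [h HE] : exists h, H = h * u by exists (H / u); rewrite divfK ?gt_eqF.
have h1 : h <= M by rewrite -(ler_pM2r u0) -HE.
have h2 : - M <= h by rewrite -(ler_pM2r u0) -HE mulNr.
have h3 : 2 * u - e * h <= 1 - (e * M) ^+ 2.
  by rewrite -(ler_pM2r u0); move: xA; rewrite HE; lra.
have eh : e * h <= e * M by rewrite ler_wpM2l.
(* The square also needs a lower bound: c <= 1/2 gives c <= 1 - c^2. *)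
have h4 : - (1 - (e * M) ^+ 2) <= 2 * u - e * h.
  move: eM eM0 eh; move: (e * M) => c; nra.
have h5 : (2 * u - e * h) ^+ 2 <= (1 - (e * M) ^+ 2) ^+ 2.
  by rewrite -subr_ge0 subr_sqr; apply: mulr_ge0; lra.
have h6 : (1 - (e * M) ^+ 2) ^+ 2 + (e * M) ^+ 2 <= 1.
  move: eM eM0; move: (e * M) => c c1 c0.
  have : c ^+ 2 <= 1 by rewrite expr_le1//; lra.
  by have := sqr_ge0 c; move: (c ^+ 2) => d d0 d1; nra.
by move: h5 h6; rewrite HE; have := sqr_ge0 (e * h); lra.
Qed.

(** Let r be the point of P nearest to y and 2x = y - r. Then <x, p - r> <= 0, <x,l> <= h_L(x) and
    <x,b> <= |x|, and these add up to the bound on 2|x|^2 = <x, y - r>. *)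
Lemma parallel_sub_subdiff P L (e : R) p l b :
  convex_body P -> convex_body L -> 0 <= e -> P p -> L l -> enorm b <= 1 ->
  exists2 x, 2 * enorm x ^+ 2 <= enorm x + e * supp_fun L x &
    subdiff (fun z => supp_fun P z + 2 * qfun z) x (p + e *: l + b).
Proof.
move=> cP cL e0 Pp Ll b1; set y := p + _ + _.
have [r Pr rmin] := nearest_point P y cP.
have [x x2] : exists x, 2 *: x = y - r.
  by exists (2^-1 *: (y - r)); rewrite scalerA mulfV// scale1r.
have xmin z : P z -> dotv x z <= dotv x r.
  move=> /rmin; rewrite -x2 dotvZr dotvC dotvDr dotvNr; lra.
exists x; last first.
  apply/subdiff_supp_qfun => //; rewrite x2 subKr; split => //.
  apply/eqP; rewrite eq_le supp_ge//=.
  by have [z Pz ->] := supp_attained P x cP; exact: xmin.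
rewrite enorm_sqr -dotvZr x2 /y !dotvE.
have := xmin _ Pp; have := ler_wpM2l e0 (supp_ge L x l cL Ll).
have := le_trans (cauchy_schwarz x b) (ler_wpM2l (enorm_ge0 x) b1).
lra.
Qed.

End ParallelSets.

(** * Polarization *)

Section Polarization.
Context {R : comNzRingType} {d m : nat}.
Variables (e : 'I_d -> 'I_m) (w : 'I_m -> R) (c : {ffun 'I_d -> 'I_m} -> R).

Let covers (f : {ffun 'I_d -> 'I_m}) := [forall i, e i \in codom f].

(* The signs are those in the expansion of prod_i (1 - [e i not in the image of f]). *)
Lemma alternating_sum_covers (f : {ffun 'I_d -> 'I_m}) :
  \sum_(S : {set 'I_d}) (-1) ^+ #|~: S| *
     \prod_j (if f j \in e @: ~: S then 0 else w (f j)) =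
  if covers f then \prod_j w (f j) else 0.
Proof.
pose a i : R := (e i \notin codom f)%:R.
transitivity ((\prod_j w (f j)) * \prod_i (1 - a i)); last first.
  case: ifPn => [/forallP cf|/forallPn[i ei]].
    by rewrite [X in _ * X]big1 ?mulr1// => i _; rewrite /a cf subr0.
  by rewrite [X in _ * X](bigD1 i)//= {1}/a ei subrr mul0r mulr0.
rewrite bigA_distr mulr_sumr; apply: eq_bigr => S _.
have -> : \prod_i (if i \in S then 1 else - a i) =
    (-1) ^+ #|~: S| * \prod_(i in ~: S) a i.
  rewrite -prodr_const -big_split/= [RHS]big_mkcond/=; apply: eq_bigr => i _.
  by rewrite inE; case: (i \in S); rewrite ?mulN1r.
rewrite mulrCA; congr (_ * _).
have [/exists_inP[i iS /codomP[j ej]]|/exists_inPn none] :=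
    boolP [exists i in ~: S, e i \in codom f].
  rewrite (bigD1 j)//= -ej imset_f// mul0r.
  by rewrite [X in _ = _ * X](bigD1 i)//= /a ej codom_f/= mul0r mulr0.
rewrite [X in _ = _ * X]big1 ?mulr1 => [|i /none]; last by rewrite /a => ->.
apply: eq_bigr => j _; case: ifPn => // /imsetP[i iS fj].
by have := none i iS; rewrite -fj codom_f.
Qed.

Hypothesis e_inj : injective e.

Let embed (s : {perm 'I_d}) : {ffun 'I_d -> 'I_m} := [ffun j => e (s j)].

(** The signs keep only the maps f whose image contains every [e i]. Filling d slots with d distinct
    values, these are the e o s for permutations s, and symmetry makes their d! terms equal. *)
Lemma polarization : (forall s, c (embed s) = c (finfun e)) ->
  \sum_(S : {set 'I_d}) (-1) ^+ #|~: S| *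
    \sum_(f : {ffun 'I_d -> 'I_m})
      (\prod_j (if f j \in e @: ~: S then 0 else w (f j))) * c f =
  d`!%:R * (\prod_i w (e i)) * c (finfun e).
Proof.
move=> csym; set rhs := RHS.
under eq_bigr => S _ do rewrite mulr_sumr.
rewrite exchange_big/=.
under eq_bigr => f _ do
  (under eq_bigr => S _ do rewrite mulrA; rewrite -mulr_suml alternating_sum_covers).
have embed_inj : injective embed.
  move=> s t /ffunP st; apply/permP => j; apply: e_inj.
  by have := st j; rewrite !ffunE.
have coversE f : covers f = (f \in embed @: [set: {perm 'I_d}]%SET).
  apply/forallP/imsetP => [cf|[s _ ->] i]; last first.
    by apply/codomP; exists (s^-1%g i); rewrite ffunE permKV.
  (* [t i] is a slot where f takes the value [e i]. It is injective because e is, so f is e composed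
     with the inverse of t. *)
  have t_ex i : exists j, e i == f j by have /codomP[j ->] := cf i; exists j.
  pose t i := xchoose (t_ex i).
  have tE i : f (t i) = e i by apply/esym/eqP; exact: (xchooseP (t_ex i)).
  have t_inj : injective t by move=> i j /(congr1 f); rewrite !tE => /e_inj.
  exists (perm t_inj)^-1%g; rewrite ?inE//; apply/ffunP => j; rewrite ffunE -tE.
  by rewrite -[t _](permE t_inj) permKV.
rewrite {}/rhs; transitivity (\sum_(f in embed @: [set: {perm 'I_d}]%SET) (\prod_j w (f j)) * c f).
  rewrite [RHS]big_mkcond/=; apply: eq_bigr => f _.
  by rewrite coversE; case: ifP => _; rewrite ?mul0r.
rewrite big_imset/=; last by move=> s t _ _; exact: embed_inj.
rewrite (eq_bigr (fun=> (\prod_i w (e i)) * c (finfun e))) => [|s _].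
  by rewrite sumr_const cardsT card_Sn -mulrA mulr_natl.
rewrite csym; congr (_ * _).
under eq_bigr do rewrite ffunE.
by rewrite [RHS](reindex_inj (@perm_inj _ s)).
Qed.

End Polarization.

(** * Partition of the directions *)

Lemma lebesgue_vol_le {R : realType} {n : nat} (A B : set 'rV[R]_n) :
  A `<=` B -> (lebesgue_vol A <= lebesgue_vol B)%E.
Proof.
move=> AB; apply: ereal_inf_le_tmp => _ [a [b [Bab ->]]].
by exists a, b; split => //; exact: subset_trans Bab.
Qed.

Section Cells.
Context {R : realType} {n : nat}.
Variables (L : set 'rV[R]_n) (M e : R).
Hypotheses (cL : convex_body L) (LM : forall l, L l -> enorm l <= M)
  (M0 : 0 < M) (e0 : 0 < e).

(* The directions u = x/|x| with M - (k+1)e < h_L(u) <= M - ke, written without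
   division so that both conditions are open or closed conditions on x. *)
Definition cell (k : nat) : set (borelRn R n) :=
  [set x : 'rV[R]_n | [/\ x != 0, enorm x < 1,
     (M - k.+1%:R * e) * enorm x < supp_fun L x &
     supp_fun L x <= (M - k%:R * e) * enorm x]].

(** On unit vectors h_L lies in [-M, M], so the index floor((M - h_L)/e) is at most floor(2M/e); the
    successor counts index 0. *)
Definition ncells : nat := (Num.truncn (2 * M / e)).+1.

Lemma measurable_open (A : set 'rV[R]_n) :
  open A -> measurable (A : set (borelRn R n)).
Proof. exact: sub_sigma_algebra. Qed.

Lemma measurable_enorm_lt (c : R) :
  measurable ([set x | enorm x < c] : set (borelRn R n)).
Proof.
apply: measurable_open; apply: (@open_comp _ _ (@enorm R n) [set y | y < c]).
  by move=> x _; exact: continuous_enorm.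
exact: open_lt.
Qed.

Lemma measurable_origin : measurable ([set 0] : set (borelRn R n)).
Proof.
rewrite -[X in measurable X]setCK; apply: measurableC.
apply: measurable_open.
rewrite (_ : ~` _ = (@enorm R n) @^-1` [set y | 0 < y]).
  apply: (@open_comp _ _ (@enorm R n)); last exact: open_gt.
  by move=> x _; exact: continuous_enorm.
by apply/seteqP; split=> x /=; rewrite enorm_gt0; [move/eqP|move=> h; exact/eqP].
Qed.

(** As h_L is a maximum of linear forms, the set is a union over l in L of open sets. *)
Lemma measurable_supp_gt (c : R) :
  measurable ([set x | c * enorm x < supp_fun L x] : set (borelRn R n)).
Proof.
apply: measurable_open.
rewrite (_ : [set _ | _] = \bigcup_(l in L) [set x | 0 < dotv x l - c * enorm x]).
  apply: bigcup_open => l Ll.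
  apply: (@open_comp _ _ (fun x : 'rV[R]_n => dotv x l - c * enorm x) [set y | 0 < y]).
    move=> x _.
    have h1 : dotv z l @[z --> x] --> dotv x l by exact: continuous_dotv.
    have h2 : enorm z @[z --> x] --> enorm x by exact: continuous_enorm.
    exact: (cvgB h1 (cvgM (cvg_cst c) h2)).
  exact: open_gt.
apply/seteqP; split=> x /=.
  by have [l Ll ->] := supp_attained L x cL; exists l => //=; rewrite subr_gt0.
by case=> l Ll /=; rewrite subr_gt0 => /lt_le_trans; apply; exact: supp_ge.
Qed.

Lemma measurable_punctured_ball : measurable (@punctured_ball R n).
Proof.
rewrite (_ : @punctured_ball _ _ = [set x | enorm x < 1] `&` ~` [set 0]).
  by apply: measurableI; [exact: measurable_enorm_lt|apply: measurableC; exact: measurable_origin].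
by apply/seteqP; split=> x /=; [case=> ? /eqP|case=> ? /eqP].
Qed.

Lemma measurable_cell k : measurable (cell k).
Proof.
rewrite (_ : cell k = @punctured_ball R n `&`
  ([set x | (M - k.+1%:R * e) * enorm x < supp_fun L x] `\`
   [set x | (M - k%:R * e) * enorm x < supp_fun L x])).
  apply: measurableI; first exact: measurable_punctured_ball.
  by apply: measurableD; exact: measurable_supp_gt.
apply/seteqP; split=> x /=.
  by case=> x0 x1 h1 h2; split => //; split => //; apply/negP; rewrite -leNgt.
by case=> -[x1 x0] [h1 /negP]; rewrite -leNgt => h2.
Qed.

Lemma cell_sub k : cell k `<=` @punctured_ball R n.
Proof. by move=> x [x0 x1 _ _]. Qed.

Lemma trivIset_cell : trivIset setT cell.
Proof.
have lt_dis i j x : (i < j)%N -> cell i x -> ~ cell j x.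
  move=> ij [x0 _ h1 _] [_ _ _ h2].
  have : i.+1%:R <= j%:R :> R by rewrite ler_nat.
  move=> /(ler_wpM2r (ltW e0)) h3.
  have := ler_wpM2r (enorm_ge0 x) (lerB (lexx M) h3); lra.
apply/trivIsetP => i j _ _ ij; apply/seteqP; split=> x //= -[ci cj].
move: ij; rewrite neq_ltn => /orP[] ij; [exact: (lt_dis i j x)|exact: (lt_dis j i x)].
Qed.

(** A point x with h = h_L(x/|x|) lies in the cell of index floor((M - h)/e). *)
Lemma bigcup_cell :
  \big[setU/set0]_(k < ncells) cell k = @punctured_ball R n.
Proof.
apply/seteqP; split=> [x|x [x1 x0]]; rewrite -bigcup_mkord.
  by case=> k _ /cell_sub.
have u0 : 0 < enorm x by rewrite enorm_gt0.
have [h hE] : exists h, supp_fun L x = h * enorm x.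
  by exists (supp_fun L x / enorm x); rewrite divfK ?gt_eqF.
have := supp_fun_bound L M x cL LM; rewrite hE normrM (ger0_norm (ltW u0)).
rewrite ler_pM2r// ler_norml => /andP[h1 h2].
have t0 : 0 <= (M - h) / e by rewrite divr_ge0 ?subr_ge0// ltW.
have /andP[k1 k2] := Num.Theory.truncn_itv t0.
set k := Num.truncn _ in k1 k2.
exists k => /=.
  rewrite /ncells -(ltr_nat R) (le_lt_trans k1)//.
  have /andP[_ /(le_lt_trans _)] := Num.Theory.truncn_itv
    (divr_ge0 (mulr_ge0 (ler0n R 2) (ltW M0)) (ltW e0)).
  by apply; rewrite ler_pM2r ?invr_gt0//; lra.
rewrite ler_pdivlMr// in k1; rewrite ltr_pdivrMr// in k2.
by split => //; rewrite hE ?ltr_pM2r ?ler_pM2r//; lra.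
Qed.

Lemma ncells_le k : (k < ncells)%N -> k%:R * e <= 2 * M.
Proof.
rewrite ltnS => kN; rewrite -ler_pdivlMr//.
have /andP[h _] := Num.Theory.truncn_itv
    (divr_ge0 (mulr_ge0 (ler0n R 2) (ltW M0)) (ltW e0)).
by apply: le_trans h; rewrite ler_nat.
Qed.

End Cells.

(** * Elementary estimates *)

Lemma le0_of_linear_bound {R : realFieldType} (x B e1 : R) : 0 < e1 ->
  (forall e, 0 < e <= e1 -> x <= B * e) -> x <= 0.
Proof.
move=> e10 h; rewrite leNgt; apply/negP => x0.
have B0 := normr_ge0 B; have B1 : 0 < `|B| + 1 by lra.
(* Chosen so that B e <= x - e < x. *)
pose e := Num.min e1 (x / (`|B| + 1)).
have e0 : 0 < e by rewrite lt_min e10 divr_gt0.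
have ee1 : e <= e1 by rewrite ge_min lexx.
have eB : e * (`|B| + 1) <= x by rewrite -ler_pdivlMr// ge_min lexx orbT.
have := h e; rewrite e0 ee1 => /(_ isT).
have := ler_wpM2r (ltW e0) (ler_norm B); nra.
Qed.

(** Letting e tend to 0 gives D = 0; dividing by e then gives |A| <= C e. *)
Lemma eq0_of_quadratic_bound {R : realFieldType} (A D C e1 : R) : 0 < e1 ->
  (forall e, 0 < e <= e1 -> `|e * A - D| <= C * e ^+ 2) -> A = 0.
Proof.
move=> e10 h.
have D0 : D = 0.
  apply/eqP; rewrite -normr_le0; apply: (@le0_of_linear_bound R _ (`|A| + `|C| * e1) _ e10).
  move=> e he; have /andP[e0 ee1] := he.
  have -> : D = e * A - (e * A - D) by ring.
  apply: (le_trans (ler_normB _ _)); rewrite normrM (gtr0_norm e0) mulrDl mulrC lerD2l.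
  apply: (le_trans (h e he)); rewrite expr2 mulrA ler_wpM2r ?(ltW e0)//.
  apply: (@le_trans _ _ (`|C| * e)); first exact: (ler_wpM2r (ltW e0) (ler_norm C)).
  exact: (ler_wpM2l (normr_ge0 C) ee1).
apply/eqP; rewrite -normr_le0; apply: (@le0_of_linear_bound R _ C _ e10).
move=> e he; have /andP[e0 _] := he; have := h e he.
by rewrite D0 subr0 normrM gtr0_norm// expr2 mulrCA ler_pM2l.
Qed.

(** Replace one factor at a time; the factors left over are bounded by 2. *)
Lemma prod_lipschitz {R : realDomainType} {I : Type} (r : seq I) (a b : I -> R) (delta : R) :
  (forall i, 0 <= a i <= 2) -> (forall i, 0 <= b i <= 2) ->
  (forall i, `|a i - b i| <= delta) ->
  `|\prod_(i <- r) a i - \prod_(i <- r) b i| <= (size r * 2 ^ size r)%:R * delta.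
Proof.
move=> a2 b2 ab.
have prod_le s : 0 <= \prod_(i <- s) b i <= (2 ^ size s)%:R.
  elim: s => [|i s /andP[s0 s1]]; first by rewrite big_nil ler01 lexx.
  have /andP[b0 b1] := b2 i.
  by rewrite big_cons mulr_ge0//= expnS natrM ler_pM.
have delta0 (i : I) : 0 <= delta by exact: le_trans (normr_ge0 _) (ab i).
elim: r => [|i r IHr]; first by rewrite !big_nil subrr normr0 mul0r.
rewrite !big_cons.
have -> (x y z t : R) : x * y - z * t = x * (y - t) + (x - z) * t by ring.
apply: (le_trans (ler_normD _ _)); rewrite !normrM.
have /andP[a0 a1] := a2 i; have /andP[p0 p1] := prod_le r.
rewrite (ger0_norm a0) (ger0_norm p0).
have h1 := ler_pM a0 (normr_ge0 _) a1 IHr.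
have h2 := ler_pM (normr_ge0 _) p0 (ab i) p1.
apply: (le_trans (lerD h1 h2)).
rewrite /= expnS -subr_ge0 [leRHS](_ : _ = delta * (2 ^ size r)%:R).
  by rewrite mulr_ge0 ?(delta0 i).
by rewrite !natrM -natr1; ring.
Qed.

(** * Mixed volumes and mixed measures *)

Section MixedMeasure.
Context {R : realType} {n : nat}.
Variables (V : ('I_n.+1 -> set 'rV[R]_n.+1) -> R)
  (MAm : ('I_n.+1 -> ('rV[R]_n.+1 -> R)) -> {measure set (borelRn R n.+1) -> \bar R}).
Hypotheses (HV : is_mixed_volume V) (HM : is_mixed_MA MAm).
Variable K : 'I_n.+1 -> set 'rV[R]_n.+1.
Hypothesis cK : forall i, convex_body (K i).

Local Notation L := (K ord_max).
Implicit Types (S : {set 'I_n.+1}) (t : R) (f : {ffun 'I_n.+1 -> 'I_n.+1})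
  (B : set (borelRn R n.+1)).

(** The weights required by [polarization]: zero at [e i] for i outside S. Indices outside the image
    of e keep their weight, which matters for the unit ball. *)
Definition masked {m} (e : 'I_n.+1 -> 'I_m) (S : {set 'I_n.+1}) (w : 'I_m -> R) i :=
  if i \in e @: ~: S then 0 else w i.

Definition weight (t : R) (i : 'I_n.+1) : R := if i == ord_max then t else 1.

Definition potential (i : 'I_n.+1) : 'rV[R]_n.+1 -> R :=
  if i == ord_max then @qfun R n.+1 else supp_fun (K i).

(* The unit ball is appended as an extra last body; the weight [t] sits on K_n. *)
Definition bodies (i : 'I_n.+2) : set 'rV[R]_n.+1 := oapp K unit_ball (unlift ord_max i).

Definition body_weight (t : R) (i : 'I_n.+2) : R := oapp (weight t) 1 (unlift ord_max i).

(** The body P_S, written with 0/1 coefficients so that it is again a Minkowski combination. The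
    last index is left out because its place is taken by q or by the separate term t L. *)
Definition partial_sum (S : {set 'I_n.+1}) : set 'rV[R]_n.+1 :=
  mink_comb (fun i => ((i \in S) && (i != ord_max))%:R) K.

Lemma convex_potential i : convex_fun (potential i).
Proof.
by rewrite /potential; case: ifP => _; [exact: convex_qfun|exact: convex_supp_fun].
Qed.

Lemma convex_bodies i : convex_body (bodies i).
Proof. by rewrite /bodies; case: unliftP => [j _|_] //=; exact: convex_body_unit_ball. Qed.

Lemma convex_partial_sum S : convex_body (partial_sum S).
Proof. exact: convex_body_mink. Qed.

Lemma masked_ge0 {m} (e : 'I_n.+1 -> 'I_m) S w i : 0 <= w i -> 0 <= masked e S w i.
Proof. by rewrite /masked; case: ifP. Qed.

Lemma masked_id S w i : masked id S w i = if i \in S then w i else 0.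
Proof. by rewrite /masked imset_id inE; case: (i \in S). Qed.

Lemma weight_ge0 t i : 0 <= t -> 0 <= weight t i.
Proof. by rewrite /weight; case: ifP. Qed.

Lemma supp_fun_partial_sum S t x : ord_max \in S ->
  \sum_i masked id S (weight t) i * potential i x =
  supp_fun (partial_sum S) x + t * qfun x.
Proof.
move=> mS; rewrite supp_fun_mink// (bigD1 ord_max)//= [in RHS](bigD1 ord_max)//=.
rewrite masked_id mS /weight /potential eqxx andbF mul0r add0r addrC; congr (_ + _).
apply: eq_bigr => i /negPf im; rewrite masked_id im andbT.
by case: (i \in S).
Qed.

(** The index of the unit ball is not in the image of [lift ord_max], so no mask removes it and the
    set is P_S + tL + B. *)
Lemma mink_bodiesE S t y : ord_max \in S ->
  mink_comb (masked (lift ord_max) S (body_weight t)) bodies y <->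
  exists p l b, [/\ partial_sum S p, L l, enorm b <= 1 & y = p + t *: l + b].
Proof.
move=> mS.
have sumE (z : 'I_n.+2 -> 'rV[R]_n.+1) :
    \sum_i masked (lift ord_max) S (body_weight t) i *: z i =
    (\sum_j ((j \in S) && (j != ord_max))%:R *: z (lift ord_max j)) +
      t *: z (lift ord_max ord_max) + z ord_max.
  rewrite big_ord_recr/=.
  rewrite (eq_bigr (fun j => (if j \in S then weight t j else 0) *: z (lift ord_max j))).
    congr (_ + _); last first.
      rewrite /masked /body_weight unlift_none/= ifF ?scale1r//.
      by apply/negP => /imsetP[j _ /eqP]; rewrite (negPf (neq_lift _ _)).
    rewrite (bigD1 ord_max)//= [in RHS](bigD1 ord_max)//= mS eqxx andbF scale0r add0r.
    rewrite /weight eqxx addrC; congr (_ + _).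
    by apply: eq_bigr => j /negPf ->; rewrite andbT; case: (j \in S).
  move=> j _.
  have -> : widen_ord (leqnSn n.+1) j = lift ord_max j.
    by apply: val_inj; rewrite /= /bump leqNgt ltn_ord.
  rewrite /masked mem_imset; last exact: lift_inj.
  by rewrite inE /body_weight liftK/=; case: (j \in S).
split=> [[z [zK ->]]|[p [l [b [[z [zK ->]] Ll b1 ->]]]]].
  have zL j : K j (z (lift ord_max j)) by have := zK (lift ord_max j); rewrite /bodies liftK.
  exists (\sum_j ((j \in S) && (j != ord_max))%:R *: z (lift ord_max j)),
    (z (lift ord_max ord_max)), (z ord_max); split; [|exact: zL| |exact: sumE].
  - by exists (fun j => z (lift ord_max j)).
  - by have := zK ord_max; rewrite /bodies unlift_none.
exists (fun i => oapp (fun j => if j == ord_max then l else z j) b (unlift ord_max i)).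
split=> [i|].
  rewrite /bodies; case: unliftP => [j _|_] //=.
  by case: eqP => [->|].
rewrite sumE unlift_none liftK/= eqxx; congr (_ + _ + _).
apply: eq_bigr => j _; rewrite liftK/=.
by case: (eqVneq j ord_max) => [_|//]; rewrite andbF !scale0r.
Qed.

(** * Volumes and Monge-Ampère measures as polynomials in the weight *)

Definition swept (S : {set 'I_n.+1}) (t : R) (A : set 'rV[R]_n.+1) : set 'rV[R]_n.+1 :=
  \bigcup_(b in A) subdiff (fun z => supp_fun (partial_sum S) z + t * qfun z) b.

(** For S containing the last index and t >= 0 this is the volume of P_S + tL + B; the polynomial
    itself makes sense for every S, as the alternating sum requires. *)
Definition vol_poly (S : {set 'I_n.+1}) (t : R) : R :=
  \sum_(f : {ffun 'I_n.+1 -> 'I_n.+2})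
    (\prod_j masked (lift ord_max) S (body_weight t) (f j)) * V (fun j => bodies (f j)).

Lemma vol_polyE S t : 0 <= t ->
  lebesgue_vol (mink_comb (masked (lift ord_max) S (body_weight t)) bodies) =
  (vol_poly S t)%:E.
Proof.
move=> t0; apply: HV.2; last exact: convex_bodies.
move=> i; apply: masked_ge0; rewrite /body_weight.
by case: unliftP => [j _|_] //=; exact: weight_ge0.
Qed.

Definition open_unit_ball : set (borelRn R n.+1) := [set x : 'rV[R]_n.+1 | enorm x < 1].

(** Every subgradient over the open ball lies in P + B, whose volume is a real number by the mixed
    volume identity; weight t = 0 removes L. *)
Lemma MA_open_unit_ball_lty :
  (MA (fun x => (\sum_i masked id [set: 'I_n.+1]%SET (weight 1) i * potential i x)%R)
    open_unit_ball < +oo)%E.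
Proof.
apply: le_lt_trans (ltry (vol_poly [set: 'I_n.+1]%SET 0)); rewrite -vol_polyE//.
apply: lebesgue_vol_le => y [x x1].
under [X in subdiff X]eq_fun do rewrite supp_fun_partial_sum ?inE//.
move/subdiff_supp_qfun => /(_ (convex_partial_sum _) ler01) [Pp _].
apply/mink_bodiesE; first by rewrite inE.
have [l Ll] := (cK ord_max).1.
exists (y - 1 *: x), l, x; split => //; first exact: ltW.
by rewrite scale0r addr0 scale1r subrK.
Qed.

Definition mass (f : {ffun 'I_n.+1 -> 'I_n.+1}) (B : set (borelRn R n.+1)) : R :=
  fine (MAm (fun j => potential (f j)) B).

(** With all weights 1, MA of the open ball is the sum of all mixed measures with coefficient 1, so
    each of them is at most one finite quantity. *)
Lemma mass_fin f B : measurable B -> B `<=` open_unit_ball ->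
  MAm (fun j => potential (f j)) B = (mass f B)%:E.
Proof.
move=> mB B1; rewrite /mass fineK//.
rewrite ge0_fin_numE ?measure_ge0//.
have mball : measurable open_unit_ball by exact: measurable_enorm_lt.
apply: (@le_lt_trans _ _ (MAm (fun j => potential (f j)) open_unit_ball)).
  by apply: le_measure => //; rewrite inE.
apply: le_lt_trans MA_open_unit_ball_lty.
rewrite (HM.2 _ _ potential)//; [|move=> i|exact: convex_potential]; last first.
  by apply: masked_ge0; exact: weight_ge0.
rewrite (bigD1 f)//= [X in X%:E](_ : _ = 1) ?mul1e; last first.
  by rewrite big1// => j _; rewrite masked_id inE /weight; case: ifP.
apply: leeDl; apply: sume_ge0 => g _; apply: mule_ge0; last exact: measure_ge0.
by rewrite lee_fin; apply: prodr_ge0 => j _; apply: masked_ge0; exact: weight_ge0.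
Qed.

Definition MA_poly (S : {set 'I_n.+1}) (t : R) (B : set (borelRn R n.+1)) : R :=
  \sum_(f : {ffun 'I_n.+1 -> 'I_n.+1})
    (\prod_j masked id S (weight t) (f j)) * mass f B.

Lemma MA_polyE S t B : ord_max \in S -> 0 <= t -> measurable B -> B `<=` open_unit_ball ->
  lebesgue_vol (swept S t B) = (MA_poly S t B)%:E.
Proof.
move=> mS t0 mB B1; rewrite /swept.
under eq_bigcupr => b _ do under [X in subdiff X]eq_fun do rewrite -supp_fun_partial_sum//.
transitivity (MA (fun x => \sum_i masked id S (weight t) i * potential i x) B) => //.
rewrite (HM.2 _ _ potential)//; [|move=> i|exact: convex_potential]; last first.
  by apply: masked_ge0; exact: weight_ge0.
rewrite /MA_poly -sumEFin; apply: eq_bigr => f _.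
by rewrite mass_fin.
Qed.

Lemma mass_ge0 f B : 0 <= mass f B.
Proof. exact: fine_ge0. Qed.

Lemma mass_setU f (A B : set (borelRn R n.+1)) :
  measurable A -> measurable B -> A `<=` open_unit_ball -> B `<=` open_unit_ball ->
  A `&` B = set0 -> mass f (A `|` B) = mass f A + mass f B.
Proof.
move=> mA mB A1 B1 AB; apply: EFin_inj; rewrite EFinD -!mass_fin//.
- exact: measureU.
- exact: measurableU.
- by rewrite subUset.
Qed.

Lemma mass_bigsetU f (F : nat -> set (borelRn R n.+1)) N :
  (forall k, measurable (F k)) -> (forall k, F k `<=` open_unit_ball) ->
  trivIset setT F ->
  mass f (\big[setU/set0]_(k < N) F k) = \sum_(k < N) mass f (F k).
Proof.
move=> mF F1 tF; apply: EFin_inj; rewrite -sumEFin -mass_fin.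
- rewrite measure_bigsetU//; apply: eq_bigr => k _.
  by rewrite -mass_fin.
- by apply: bigsetU_measurable => k _; exact: mF.
- by rewrite -bigcup_mkord; exact: bigcup_sub.
Qed.

Lemma MA_poly_setU S t (A B : set (borelRn R n.+1)) :
  measurable A -> measurable B -> A `<=` open_unit_ball -> B `<=` open_unit_ball ->
  A `&` B = set0 -> MA_poly S t (A `|` B) = MA_poly S t A + MA_poly S t B.
Proof.
move=> mA mB A1 B1 AB; rewrite -big_split/=; apply: eq_bigr => f _.
by rewrite mass_setU// mulrDr.
Qed.

Lemma MA_poly_bigsetU S t (F : nat -> set (borelRn R n.+1)) N :
  (forall k, measurable (F k)) -> (forall k, F k `<=` open_unit_ball) ->
  trivIset setT F ->
  MA_poly S t (\big[setU/set0]_(k < N) F k) = \sum_(k < N) MA_poly S t (F k).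
Proof.
move=> mF F1 tF; rewrite exchange_big/=; apply: eq_bigr => f _.
by rewrite mass_bigsetU// mulr_sumr.
Qed.

Lemma MA_poly_lipschitz S t t' B : 0 <= t <= 2 -> 0 <= t' <= 2 ->
  `|MA_poly S t B - MA_poly S t' B| <=
  (n.+1 * 2 ^ n.+1)%:R * `|t - t'| * \sum_f mass f B.
Proof.
move=> t2 t'2; rewrite -sumrB mulr_sumr.
apply: (le_trans (ler_norm_sum _ _ _)); apply: ler_sum => f _.
rewrite -mulrBl normrM (ger0_norm (mass_ge0 _ _)) ler_wpM2r ?mass_ge0//.
have bnd (s : R) j : 0 <= s <= 2 -> 0 <= masked id S (weight s) (f j) <= 2.
  move=> s2; rewrite masked_id /weight; case: ifP => _; last by rewrite lexx ler0n.
  by case: ifP => // _; rewrite ler01 ler1n.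
have := @prod_lipschitz R _ (index_enum 'I_n.+1) (fun j => masked id S (weight t) (f j))
  (fun j => masked id S (weight t') (f j)) `|t - t'|.
rewrite -[index_enum _]enumT size_enum_ord; apply=> j; [exact: bnd|exact: bnd|].
rewrite !masked_id /weight; case: ifP => _; last by rewrite subrr normr0.
by case: ifP => // _; rewrite subrr normr0.
Qed.

(** * Polarized identities *)

Lemma masked_weight_notin S t t' i : ord_max \notin S ->
  masked id S (weight t) i = masked id S (weight t') i.
Proof.
by move=> mS; rewrite !masked_id /weight; case: eqP => // ->; rewrite (negPf mS).
Qed.

Lemma MA_poly_notin S t t' B : ord_max \notin S -> MA_poly S t B = MA_poly S t' B.
Proof.
move=> mS; apply: eq_bigr => f _; congr (_ * _); apply: eq_bigr => j _.
exact: masked_weight_notin.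
Qed.

Lemma vol_poly_notin S t t' : ord_max \notin S -> vol_poly S t = vol_poly S t'.
Proof.
move=> mS; apply: eq_bigr => f _; congr (_ * _); apply: eq_bigr => j _.
rewrite /masked /body_weight; case: unliftP => [i ->|->] //=.
rewrite mem_imset; last exact: lift_inj.
rewrite inE /weight; case: eqP => // ->.
by rewrite mS.
Qed.

Lemma prod_weight t : \prod_i weight t i = t.
Proof.
rewrite (bigD1 ord_max)//= {1}/weight eqxx big1 ?mulr1// => i /negPf im.
by rewrite /weight im.
Qed.

Lemma vol_polarization t :
  \sum_(S : {set 'I_n.+1}) (-1) ^+ #|~: S| * vol_poly S t = n.+1`!%:R * t * V K.
Proof.
have bodiesE (g : 'I_n.+1 -> 'I_n.+1) :
    (fun j => bodies ([ffun j => lift ord_max (g j)] j)) = (fun j => K (g j)).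
  by apply/funext => j; rewrite ffunE /bodies liftK.
have := @polarization R n.+1 n.+2 (lift ord_max) (body_weight t)
  (fun g : {ffun 'I_n.+1 -> 'I_n.+2} => V (fun j => bodies (g j))) (@lift_inj _ _).
rewrite (bodiesE id) => ->; last by move=> s; rewrite bodiesE; exact: HV.1.
congr (_ * _ * _); rewrite -[RHS]prod_weight; apply: eq_bigr => i _.
by rewrite /body_weight liftK.
Qed.

Lemma MA_polarization t B : measurable B ->
  \sum_(S : {set 'I_n.+1}) (-1) ^+ #|~: S| * MA_poly S t B =
  n.+1`!%:R * t * fine (MAm potential B).
Proof.
move=> mB.
have potE (g : 'I_n.+1 -> 'I_n.+1) :
    (fun j => potential ([ffun j => g j] j)) = (fun j => potential (g j)).
  by apply/funext => j; rewrite ffunE.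
have := @polarization R n.+1 n.+1 id (weight t) (fun f => mass f B) (fun _ _ h => h).
rewrite /mass (potE id) => ->; last first.
  by move=> s; rewrite potE HM.1//; exact: convex_potential.
by rewrite prod_weight.
Qed.

(** Taken over the whole punctured ball, which the cells partition, so that it does not depend on
    e. *)
Definition lipschitz_const : R :=
  (n.+1 * 2 ^ n.+1)%:R * \sum_f mass f (@punctured_ball R n.+1).

Lemma lipschitz_const_ge0 : 0 <= lipschitz_const.
Proof. by rewrite mulr_ge0//; apply: sumr_ge0 => f _; exact: mass_ge0. Qed.

(** * Two-sided comparison of volumes with sums over cells *)

Section Sandwich.
Variables (M e : R).
Hypotheses (LM : forall l, L l -> enorm l <= M) (M0 : 0 < M) (e0 : 0 < e)
  (eM : e * M <= 1 / 4) (e4 : e <= 1 / 4).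

Let N := ncells M e.
Let C := cell L M e.
(* Replaces 1 + e h_L(u) on the k-th cell. *)
Definition radius (k : nat) : R := 1 + e * (M - k.+1%:R * e).

Lemma radius_bound k : (k < N)%N -> 1 / 2 <= radius k <= 3 / 2.
Proof.
move=> kN; have h := ncells_le M e M0 e0 k kN.
have ke0 : 0 <= k%:R * e by rewrite mulr_ge0// ltW.
have h1 := ler_wpM2l (ltW e0) h; have h2 := mulr_ge0 (ltW e0) ke0.
have h3 := ler_wpM2l (ltW e0) e4.
rewrite /radius -[k.+1%:R]natr1; move: h1 h2 h3 eM e4; move: (k%:R : R) => a.
by have := sqr_ge0 e => h0 h1 h2 h3 h4 h5; apply/andP; split; lra.
Qed.

Lemma cell_sub_ball k : C k `<=` open_unit_ball.
Proof. by move=> x [_ x1 _ _]. Qed.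

(* Rescaling all the cells to the common weight 2 of q makes the differently
   sized layers disjoint images under a single potential, where MA is additive. *)
Lemma shrunk_cellE k (r : R) : 0 < r <= 2 ->
  C k `&` [set x | enorm x < r / 2] = [set x | C k ((2 / r) *: x)].
Proof.
case/andP => r0 r2.
have c0 : 0 < 2 / r by rewrite divr_gt0.
have c1 : 1 <= 2 / r by rewrite ler_pdivlMr// mul1r.
have rE (u : R) : (2 / r * u < 1) = (u < r / 2).
  by rewrite mulrC mulrA ltr_pdivrMr// mul1r ltr_pdivlMr.
apply/seteqP; split=> x /=.
  case=> -[x0 x1 h1 h2] xr; split.
  - by rewrite scaler_eq0 negb_or gt_eqF.
  - by rewrite enormZ ?(ltW c0)// rE.
  - by rewrite enormZ ?supp_funZ ?(ltW c0)// mulrCA ltr_pM2l.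
  - by rewrite enormZ ?supp_funZ ?(ltW c0)// mulrCA ler_pM2l.
case; rewrite !enormZ ?supp_funZ ?(ltW c0)// rE scaler_eq0 gt_eqF//= => x0 x1.
rewrite mulrCA ltr_pM2l// => h1; rewrite mulrCA ler_pM2l// => h2.
split=> //; split=> //; apply: lt_le_trans x1 _.
by rewrite ler_pdivrMr// mul1r.
Qed.

(** Under weight 2 the cell shrunk by r/2 has the same image as the full cell under weight r. The
    bound r <= 2 keeps the shrunk cell inside the ball. *)
Lemma MA_poly_shrunk S k (r : R) : ord_max \in S -> 0 < r <= 2 ->
  MA_poly S 2 (C k `&` [set x | enorm x < r / 2]) = MA_poly S r (C k).
Proof.
move=> mS r2; have /andP[r0 _] := r2.
have mC : measurable (C k) by exact: measurable_cell.
apply: EFin_inj; rewrite -!MA_polyE ?(ltW r0)//.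
- rewrite shrunk_cellE// /swept [in RHS](bigcup_subdiff_scale _ _ 2)//.
  exact: convex_partial_sum.
- exact: cell_sub_ball.
- by apply: measurableI => //; exact: measurable_enorm_lt.
- by move=> x [/cell_sub_ball].
Qed.

Definition shrunk (r : nat -> R) (k : nat) : set (borelRn R n.+1) :=
  C k `&` [set x | enorm x < r k / 2].

(** The subdifferential at the origin is P_S itself, hence the extra point. *)
Definition shrunk_union (r : nat -> R) : set (borelRn R n.+1) :=
  [set 0] `|` \big[setU/set0]_(k < N) shrunk r k.

Lemma swept_shrunk_union S (r : nat -> R) : ord_max \in S ->
  (forall k, (k < N)%N -> 0 < r k <= 2) ->
  lebesgue_vol (swept S 2 (shrunk_union r)) =
  (MA_poly S 2 [set 0] + \sum_(k < N) MA_poly S (r k) (C k))%:E.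
Proof.
move=> mS r2.
have mF k : measurable (shrunk r k).
  by apply: measurableI; [exact: measurable_cell|exact: measurable_enorm_lt].
have FC k : (shrunk r k) `<=` C k by move=> x [].
have F1 k : (shrunk r k) `<=` open_unit_ball.
  exact: subset_trans (@cell_sub_ball k).
have tF : trivIset setT (shrunk r).
  apply/trivIsetP => i j _ _ ij; apply/seteqP; split=> x //= -[/FC xi /FC xj].
  have /trivIsetP/(_ i j I I ij) := trivIset_cell L M e e0.
  by move=> h; rewrite -[False]/(set0 x) -h.
have mU : measurable (\big[setU/set0]_(k < N) shrunk r k).
  by apply: bigsetU_measurable => k _; exact: mF.
have U1 : \big[setU/set0]_(k < N) shrunk r k `<=` open_unit_ball.
  by rewrite -bigcup_mkord; apply: bigcup_sub => k _; exact: F1.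
have o1 : [set 0] `<=` open_unit_ball by move=> x ->; rewrite /open_unit_ball/= enorm0.
have mo := @measurable_origin R n.+1.
rewrite MA_polyE//; [|exact: measurableU|by rewrite subUset].
rewrite MA_poly_setU//; last first.
  by rewrite -bigcup_mkord; apply/seteqP; split=> [x [-> [k _ [[/eqP]]]]|].
rewrite MA_poly_bigsetU//; congr (_ + _)%:E; apply: eq_bigr => k _.
by rewrite MA_poly_shrunk// r2.
Qed.

(** On the k-th cell 1 + e h_L(u) exceeds [radius k], so lowering the radius by (eM)^2 meets the
    hypothesis of [subdiff_sub_parallel]. *)
Lemma vol_poly_ge S : ord_max \in S ->
  MA_poly S 2 [set 0] + \sum_(k < N) MA_poly S (radius k - e ^+ 2 * M ^+ 2) (C k)
  <= vol_poly S e.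
Proof.
move=> mS; rewrite -lee_fin -(vol_polyE _ _ (ltW e0)).
rewrite -(swept_shrunk_union _ (fun k => radius k - e ^+ 2 * M ^+ 2))//; last first.
  move=> k /radius_bound /andP[r0 r1].
  have : 0 <= e * M by rewrite mulr_ge0// ltW.
  by rewrite -exprMn; move: eM; move: (e * M) => c; nra.
apply: lebesgue_vol_le => y [x xU sub].
apply/mink_bodiesE => //.
have eM2 : e * M <= 1 / 2 by apply: le_trans eM _; lra.
apply: (subdiff_sub_parallel _ _ _ _ _ _ (convex_partial_sum S) (cK ord_max) LM
  (ltW e0) (ltW M0) eM2 _ sub).
move: xU; rewrite /shrunk_union -bigcup_mkord.
case=> [->|[k _ [[x0 x1 h1 _]]]] /=; first by rewrite enorm0 supp_fun0// expr0n !mulr0 addr0.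
have := enorm_ge0 x => u0 /ltW h2.
have h3 := ler_wpM2r u0 h2; have h4 := ltW h1.
have := ler_wpM2l (ltW e0) h4.
move: h3; rewrite /radius; lra.
Qed.

(** On the k-th cell 1 + e h_L(u) <= [radius k] + e^2; the second e^2 provides the strict inequality
    in [shrunk]. *)
Lemma vol_poly_le S : ord_max \in S ->
  vol_poly S e <=
  MA_poly S 2 [set 0] + \sum_(k < N) MA_poly S (radius k + 2 * e ^+ 2) (C k).
Proof.
move=> mS; rewrite -lee_fin -(vol_polyE _ _ (ltW e0)).
rewrite -(swept_shrunk_union _ (fun k => radius k + 2 * e ^+ 2))//; last first.
  by move=> k /radius_bound /andP[r0 r1]; move: e0 e4; nra.
apply: lebesgue_vol_le => y /mink_bodiesE => /(_ mS)[p [l [b [Pp Ll b1 ->]]]].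
have [x xA sub] := parallel_sub_subdiff _ _ e p l b (convex_partial_sum S) (cK ord_max)
  (ltW e0) Pp Ll b1.
exists x => //; rewrite /shrunk_union -bigcup_mkord.
have [->|x0] := eqVneq x 0; [by left|right].
have u0 : 0 < enorm x by rewrite enorm_gt0.
have := supp_fun_bound L M x (cK _) LM; rewrite ler_norml => /andP[_ hM].
have eh := ler_wpM2l (ltW e0) hM.
(* Indeed 2|x| <= 1 + eM <= 5/4. *)
have x1 : enorm x < 1.
  rewrite -(ltr_pM2r u0) mul1r.
  have := ler_wpM2r (ltW u0) eM; move: xA eh; move: (supp_fun _ _) (enorm x) u0 => H u; nra.
have : @punctured_ball R n.+1 x by [].
rewrite -(bigcup_cell L M e (cK _) LM M0 e0) -bigcup_mkord => -[k kN Ck].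
exists k => //; split=> //=.
case: Ck => _ _ _ h2.
rewrite -(ltr_pM2r u0).
have := ler_wpM2l (ltW e0) h2.
have : 0 < e ^+ 2 * enorm x by rewrite mulr_gt0// exprn_gt0.
move: xA; rewrite /radius -[k.+1%:R]natr1; lra.
Qed.

Lemma sum_mass_cell f :
  \sum_(k < N) mass f (C k) = mass f (@punctured_ball R n.+1).
Proof.
rewrite -mass_bigsetU; first by rewrite (bigcup_cell _ _ _ (cK _) LM M0 e0).
- by move=> k; exact: measurable_cell.
- exact: cell_sub_ball.
- exact: trivIset_cell.
Qed.

Lemma sum_MA_poly_lipschitz S s :
  (forall k, (k < N)%N -> 0 <= radius k + s <= 2) ->
  `|\sum_(k < N) MA_poly S (radius k + s) (C k) -
    \sum_(k < N) MA_poly S (radius k) (C k)| <= lipschitz_const * `|s|.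
Proof.
move=> s2; rewrite -sumrB; apply: (le_trans (ler_norm_sum _ _ _)).
apply: (@le_trans _ _ (\sum_(k < N) (n.+1 * 2 ^ n.+1)%:R * `|s| * \sum_f mass f (C k))).
  apply: ler_sum => k _.
  have rk : 0 <= radius k <= 2.
    by have /andP[r0 r1] := radius_bound k (ltn_ord k); apply/andP; split; lra.
  apply: (le_trans (MA_poly_lipschitz S _ _ _ (s2 k (ltn_ord k)) rk)).
  by rewrite addrAC subrr add0r.
rewrite -mulr_sumr exchange_big/=.
under eq_bigr => f _ do rewrite sum_mass_cell.
by rewrite mulrAC.
Qed.

(** The two bounds shift the radii by e^2 M^2 and 2 e^2; the factor M^2 + 2 covers both. *)
Lemma vol_poly_approx S : ord_max \in S ->
  `|vol_poly S e - MA_poly S 2 [set 0] - \sum_(k < N) MA_poly S (radius k) (C k)| <=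
  lipschitz_const * (M ^+ 2 + 2) * e ^+ 2.
Proof.
move=> mS.
have c0 := lipschitz_const_ge0.
have eM0 : 0 <= e * M by rewrite mulr_ge0// ltW.
have eM2 : 0 <= e ^+ 2 * M ^+ 2 <= 1 / 16.
  by rewrite -exprMn; move: eM eM0; move: (e * M) => c; nra.
have e2 : 0 <= e ^+ 2 <= 1 / 16 by move: e0 e4; nra.
have hlow : forall k, (k < N)%N -> 0 <= radius k + - (e ^+ 2 * M ^+ 2) <= 2.
  by move=> k /radius_bound /andP[r0 r1]; lra.
have hup : forall k, (k < N)%N -> 0 <= radius k + 2 * e ^+ 2 <= 2.
  by move=> k /radius_bound /andP[r0 r1]; lra.
have /andP[e20 _] := e2; have /andP[eM20 _] := eM2.
have := sum_MA_poly_lipschitz S _ hlow; have := sum_MA_poly_lipschitz S _ hup.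
rewrite normrN (ger0_norm eM20) (ger0_norm (mulr_ge0 (ler0n R 2) e20)).
have := vol_poly_ge S mS; have := vol_poly_le S mS.
have := mulr_ge0 c0 e20; have := mulr_ge0 c0 eM20.
rewrite !ler_norml.
move: (\sum_(k < N) MA_poly S (radius k) (C k)) (\sum_(k < N) _) (\sum_(k < N) _).
move: (vol_poly S e) (MA_poly S 2 _) lipschitz_const => v w c x y z.
lra.
Qed.

End Sandwich.

(** * Finiteness, and the mass of the origin *)

Lemma mixed_fin B : measurable B -> B `<=` open_unit_ball ->
  MAm potential B = (fine (MAm potential B))%:E.
Proof.
move=> mB B1; have := mass_fin [ffun j => j] B mB B1.
rewrite (_ : (fun j => _) = potential); last by apply/funext => j; rewrite ffunE.
by move=> ->.
Qed.

Lemma punctured_sub : @punctured_ball R n.+1 `<=` open_unit_ball.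
Proof. by move=> x []. Qed.

(** The set {0} is invariant under the rescaling that changes the weight. *)
Lemma MA_poly_origin S t t' : 0 < t -> 0 < t' ->
  MA_poly S t [set 0] = MA_poly S t' [set 0].
Proof.
move=> t0 t'0; have [mS|mS] := boolP (ord_max \in S); last exact: MA_poly_notin.
have o1 : [set 0] `<=` open_unit_ball by move=> x ->; rewrite /open_unit_ball/= enorm0.
have mo := @measurable_origin R n.+1.
apply: EFin_inj; rewrite -!MA_polyE ?(ltW t0) ?(ltW t'0)//; congr lebesgue_vol.
rewrite /swept (bigcup_subdiff_scale _ t t')//; last exact: convex_partial_sum.
congr (\bigcup_(b in _) _); apply/seteqP; split=> x /=; last by move=> ->; rewrite scaler0.
by move/eqP; rewrite scaler_eq0 gt_eqF ?divr_gt0//= => /eqP.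
Qed.

(* The image of {0} does not depend on the weight of q, whereas the polarized
   identity is linear in that weight. *)
Lemma mixed_origin : MAm potential [set 0] = 0%E.
Proof.
have mo := @measurable_origin R n.+1.
rewrite mixed_fin//; last by move=> x ->; rewrite /open_unit_ball/= enorm0.
have := MA_polarization 2 _ mo; have := MA_polarization 1 _ mo.
under eq_bigr do rewrite (MA_poly_origin _ 1 2)//.
move=> ->; have : 0 < n.+1`!%:R :> R by rewrite ltr0n fact_gt0.
move: (fine _) (_`!%:R) => a c c0 h; congr _%:E.
by apply: (mulfI (lt0r_neq0 c0)); rewrite mulr0; lra.
Qed.

(** * Riemann sums and the integral *)

Section Estimate.
Variable M : R.
Hypotheses (LM : forall l, L l -> enorm l <= M) (M0 : 0 < M).

Local Notation cellmass e k := (fine (MAm potential (cell L M e k))).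

Lemma sum_cell_mass e : 0 < e ->
  \sum_(k < ncells M e) cellmass e k = fine (MAm potential (@punctured_ball R n.+1)).
Proof.
move=> e0; apply: EFin_inj; rewrite -sumEFin.
rewrite (eq_bigr (fun k : 'I__ => MAm potential (cell L M e k))); last first.
  by move=> k _; rewrite -mixed_fin//; [exact: measurable_cell|exact: cell_sub_ball].
rewrite -mixed_fin; [|exact: measurable_punctured_ball|exact: punctured_sub].
rewrite -(bigcup_cell L M e (cK _) LM M0 e0) measure_bigsetU//.
- by move=> k; exact: measurable_cell.
- exact: trivIset_cell.
Qed.

(** The volumes polarize to n! e V(K), the sums over cells to n! times (total mass + e times the
    Riemann sum), and they agree term by term up to O(e^2). C and D must not depend on e, although
    the partition does. *)
Lemma riemann_sum_estimate : exists C D : R, forall e : R,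
  0 < e -> e * M <= 1 / 4 -> e <= 1 / 4 ->
  `|e * (n.+1`!%:R *
      (V K - \sum_(k < ncells M e) (M - k.+1%:R * e) * cellmass e k)) - D| <= C * e ^+ 2.
Proof.
pose pb := @punctured_ball R n.+1.
(* The contribution of S that does not depend on e. *)
pose base S : R := if ord_max \in S then MA_poly S 2 [set 0]
  else vol_poly S 0 - MA_poly S 0 pb.
exists (\sum_(S : {set 'I_n.+1}) lipschitz_const * (M ^+ 2 + 2)).
exists (\sum_(S : {set 'I_n.+1}) (-1) ^+ #|~: S| * base S +
  n.+1`!%:R * fine (MAm potential pb)) => e e0 eM e4.
have mC k : measurable (cell L M e k) by exact: measurable_cell.
(* Polarization on each cell with weight [radius M e k], which is 1 plus e times the lower level of
   h_L there. *)
have sumE : n.+1`!%:R * (fine (MAm potential pb) +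
      e * \sum_(k < ncells M e) (M - k.+1%:R * e) * cellmass e k) =
    \sum_(S : {set 'I_n.+1}) (-1) ^+ #|~: S| *
      \sum_(k < ncells M e) MA_poly S (radius M e k) (cell L M e k).
  under [RHS]eq_bigr do rewrite mulr_sumr.
  rewrite exchange_big/= -(sum_cell_mass e e0) !mulr_sumr -big_split/= mulr_sumr.
  by apply: eq_bigr => k _; rewrite MA_polarization// /radius; ring.
rewrite [X in `|X|](_ : _ = \sum_(S : {set 'I_n.+1}) (-1) ^+ #|~: S| *
  (vol_poly S e - base S -
    \sum_(k < ncells M e) MA_poly S (radius M e k) (cell L M e k))).
  apply: (le_trans (ler_norm_sum _ _ _)); rewrite mulr_suml.
  apply: ler_sum => S _; rewrite normrM normrX normrN1 expr1n mul1r /base.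
  case: ifPn => mS; first exact: vol_poly_approx.
  (* Without the last index nothing depends on the weight: the cells merge into the punctured ball
     and the difference vanishes exactly. *)
  rewrite (vol_poly_notin S e 0)//.
  under eq_bigr do rewrite (MA_poly_notin _ _ 0)//.
  rewrite -MA_poly_bigsetU//; last 2 first.
  - by move=> k x [].
  - exact: trivIset_cell.
  rewrite (bigcup_cell L M e (cK _) LM M0 e0) opprB addrA addrAC subrr add0r subrr normr0.
  by rewrite mulr_ge0 ?sqr_ge0// mulr_ge0 ?lipschitz_const_ge0// addr_ge0 ?sqr_ge0.
under [RHS]eq_bigr do rewrite !mulrDr !mulrN.
rewrite !big_split/= !sumrN -sumE vol_polarization; ring.
Qed.

Definition sphere_ext (x : 'rV[R]_n.+1) : R := supp_fun L ((enorm x)^-1 *: x).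

Lemma sphere_ext_cell e k x : cell L M e k x ->
  M - k.+1%:R * e < sphere_ext x <= M - k%:R * e.
Proof.
case=> x0 _ h1 h2; have u0 : 0 < enorm x by rewrite enorm_gt0.
rewrite /sphere_ext supp_funZ ?invr_ge0 ?enorm_ge0// [_^-1 * _]mulrC.
by rewrite ltr_pdivlMr// ler_pdivrMr// h1 h2.
Qed.

Lemma integrable_sphere_ext :
  (MAm potential).-integrable (@punctured_ball R n.+1) (EFin \o sphere_ext).
Proof.
have mP := @measurable_punctured_ball R n.+1.
have sE x : x != 0 -> forall c, (c < sphere_ext x) = (c * enorm x < supp_fun L x).
  move=> x0 c; rewrite /sphere_ext supp_funZ ?invr_ge0 ?enorm_ge0// [_^-1 * _]mulrC.
  by rewrite ltr_pdivlMr ?enorm_gt0.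
apply: measurable_bounded_integrable => //.
- by rewrite mixed_fin ?ltry//; exact: punctured_sub.
- move=> _; apply: (measurability _ (measurable_realfun.RGenOInfty.measurableE R)) => //.
  move=> _ [_ [c ->] <-].
  rewrite (_ : _ `&` _ = @punctured_ball R n.+1 `&` [set x | c * enorm x < supp_fun L x]).
    by apply: measurableI => //; exact: measurable_supp_gt.
  apply/seteqP; split=> x [[x1 x0]] /=; rewrite in_itv/= andbT => h.
    by split; [split|rewrite /= -sE].
  by split; [split|rewrite /= sE].
- exists M; split; first exact: num_real.
  move=> M' MM' x [x1 x0]; rewrite /= (le_trans _ (ltW MM'))//.
  have u0 : 0 < enorm x by rewrite enorm_gt0.
  have := supp_fun_bound L M ((enorm x)^-1 *: x) (cK _) LM.
  by rewrite enormZ ?invr_ge0 ?enorm_ge0// mulVf ?gt_eqF// mulr1.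
Qed.

(** On each cell the integrand lies between two levels at distance e, so lower and upper sums
    enclose the integral and differ by e times the total mass. *)
Lemma integral_riemann_sum e : 0 < e ->
  `|fine (\int[MAm potential]_(x in @punctured_ball R n.+1) (sphere_ext x)%:E)%E -
    \sum_(k < ncells M e) (M - k.+1%:R * e) * cellmass e k| <=
  fine (MAm potential (@punctured_ball R n.+1)) * e.
Proof.
move=> e0; set I := fine _.
have mP := @measurable_punctured_ball R n.+1.
have mC k : measurable (cell L M e k) by exact: measurable_cell.
have C1 k : cell L M e k `<=` open_unit_ball by move=> x [].
have IE : (\int[MAm potential]_(x in @punctured_ball R n.+1) (sphere_ext x)%:E =
    \sum_(k < ncells M e) \int[MAm potential]_(x in cell L M e k) (sphere_ext x)%:E)%E.
  have D : \big[setU/set0]_(k < ncells M e) cell L M e k = @punctured_ball R n.+1.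
    exact: bigcup_cell.
  rewrite -[in LHS]D integral_bigsetU_EFin//.
  - exact: index_enum_uniq.
  - apply/trivIsetP => i j _ _ ij.
    have /trivIsetP := trivIset_cell L M e e0.
    exact.
  - by rewrite D; have /integrableP[] := integrable_sphere_ext.
have intC k : (MAm potential).-integrable (cell L M e k) (EFin \o sphere_ext).
  by apply: (integrableS mP) (integrable_sphere_ext) => //; exact: cell_sub.
have cstC k (r : R) : (MAm potential).-integrable (cell L M e k) (EFin \o cst r).
  apply: measurable_bounded_integrable => //; first by rewrite mixed_fin ?ltry.
  by exists `|r|; split; [exact: num_real|move=> M' /ltW h x _].
have lo k : (((M - k.+1%:R * e) * cellmass e k)%R%:E <=
    \int[MAm potential]_(x in cell L M e k) (sphere_ext x)%:E)%E.
  rewrite EFinM -mixed_fin// -integral_cst//; apply: le_integral => //.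
    exact: cstC.
  by move=> x; rewrite inE => /sphere_ext_cell /andP[/ltW h _]; rewrite lee_fin.
have hi k : (\int[MAm potential]_(x in cell L M e k) (sphere_ext x)%:E <=
    ((M - k%:R * e) * cellmass e k)%R%:E)%E.
  rewrite EFinM -mixed_fin// -integral_cst//; apply: le_integral => //.
    exact: cstC.
  by move=> x; rewrite inE => /sphere_ext_cell /andP[_ h]; rewrite lee_fin.
have IF : (\int[MAm potential]_(x in @punctured_ball R n.+1) (sphere_ext x)%:E = I%:E)%E.
  by rewrite /I fineK//; exact: integrable_fin_num integrable_sphere_ext.
have I1 : \sum_(k < ncells M e) (M - k.+1%:R * e) * cellmass e k <= I.
  by rewrite -lee_fin -IF IE -sumEFin; apply: lee_sum => k _; exact: lo.
have I2 : I <= \sum_(k < ncells M e) (M - k%:R * e) * cellmass e k.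
  by rewrite -lee_fin -IF IE -sumEFin; apply: lee_sum => k _; exact: hi.
rewrite ger0_norm ?subr_ge0// lerBlDr (le_trans I2)//.
rewrite -(sum_cell_mass e e0) mulr_suml -big_split/=; apply: ler_sum => k _.
by rewrite -natr1; lra.
Qed.

End Estimate.

Lemma mixed_volume_integral :
  (V K)%:E = (\int[MAm potential]_(x in @punctured_ball R n.+1) (sphere_ext x)%:E)%E.
Proof.
have [M M0 LM] := convex_body_bounded (K ord_max) (cK _).
have intS := integrable_sphere_ext M LM.
have -> : (\int[MAm potential]_(x in @punctured_ball R n.+1) (sphere_ext x)%:E =
    (fine (\int[MAm potential]_(x in @punctured_ball R n.+1) (sphere_ext x)%:E))%:E)%E.
  rewrite fineK//.
  by apply: integrable_fin_num => //; exact: measurable_punctured_ball.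
have approx := integral_riemann_sum M LM M0; congr _%:E.
set I := fine _ in approx *; set m := fine _ in approx.
have [C [D est]] := riemann_sum_estimate M LM M0.
pose c : R := n.+1`!%:R.
have c0 : 0 < c by rewrite ltr0n fact_gt0.
(* Ensures both e <= 1/4 and eM <= 1/4. *)
pose e1 : R := Num.min (1 / 4) (1 / 4 / M).
have e10 : 0 < e1 by rewrite lt_min !divr_gt0.
have bnd e : 0 < e <= e1 -> `|e * (c * (V K - I)) - D| <= (C + c * m) * e ^+ 2.
  rewrite le_min => /and3P[e0 e4]; rewrite ler_pdivlMr// => eM.
  have := est e e0 eM e4; have := approx e e0.
  set s := \sum_(k < _) _ => h1 h2.
  (* Exchanging the Riemann sum s for the integral I costs e c |I - s| <= c m e^2, of the order
     already allowed. *)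
  have -> : e * (c * (V K - I)) - D = (e * (c * (V K - s)) - D) - e * c * (I - s) by ring.
  apply: (le_trans (ler_normB _ _)); rewrite mulrDl lerD//.
  rewrite normrM gtr0_norm ?mulr_gt0//.
  have := ler_wpM2l (ltW (mulr_gt0 e0 c0)) h1; lra.
have /eqP := eq0_of_quadratic_bound _ _ _ _ e10 bnd.
by rewrite mulf_eq0 gt_eqF//= subr_eq0 => /eqP.
Qed.

End MixedMeasure.

(* Dimension written n.+1 (n >= 1); K_1..K_n are K 0 .. K ord_max. *)
Theorem theorem4p5 (R : realType) (n : nat)
  (V : ('I_n.+1 -> set 'rV[R]_n.+1) -> R)
  (MAm : ('I_n.+1 -> ('rV[R]_n.+1 -> R)) -> {measure set (borelRn R n.+1) -> \bar R}) :
  is_mixed_volume V -> is_mixed_MA MAm ->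
  forall K : 'I_n.+1 -> set 'rV[R]_n.+1, (forall i, convex_body (K i)) ->
  let mu := MAm (fun i => if i == ord_max then @qfun R n.+1 else supp_fun (K i)) in
  mu [set (0 : 'rV[R]_n.+1)] = 0%E /\
  (V K)%:E =
  (\int[mu]_(x in @punctured_ball R n.+1)
      (supp_fun (K ord_max) ((enorm (x : 'rV[R]_n.+1))^-1 *: (x : 'rV[R]_n.+1)))%:E)%E.
Proof.
move=> HV HM K cK mu; split.
- exact: mixed_origin HV HM _ cK.
- exact: mixed_volume_integral HV HM _ cK.
Qed.
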